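(* Suppose that for all integers $n\ge3$, $d\ge0$ and $j$ with $2\le j\le n-1$ one has \[ b_{n,d}(1,j)+b_{n,d}(j,1)=2\,p_{n,d}(1,j). \] Then for every $n\ge1$ and every $d$ with $0\le d\le\lfloor (n-1)/2\rfloor$, the number of ballot permutations of $[n]$ with exactly $d$ descents equals the number of odd order permutations of $[n]$ with cyclic weight $d$, i.e. $b_{n,d}=p_{n,d}$.
   Context: For a permutation $\pi=\pi_1\cdots\pi_n$ of $[n]$ (one-line notation), an ascent is a position $t$ with $\pi_t<\pi_{t+1}$ and a descent one with $\pi_t>\pi_{t+1}$; the height of a word is its number of ascents minus its number of descents. $\pi$ is a ballot permutation if every prefix $\pi_1\cdots\pi_t$ has nonnegative height. $\mathscr{B}_{n,d}$ is the set of ballot permutations of $[n]$ with exactly $d$ descents, $b_{n,d}=\lvert\mathscr{B}_{n,d}\rvert$, and $b_{n,d}(i,j)$ is the number of $\pi\in\mathscr{B}_{n,d}$ containing $i\,n\,j$ as a factor ($\pi_t=i,\pi_{t+1}=n,\pi_{t+2}=j$ for some $t$). A cycle $(c_1\cdots c_k)$ means $c_1\mapsto c_2\mapsto\cdots\mapsto c_k\mapsto c_1$; $\operatorname{cdes}(c)=\lvert\{t\in[k]:c_t>c_{t+1}\}\rvert$, $\operatorname{casc}(c)=\lvert\{t\in[k]:c_t<c_{t+1}\}\rvert$ with $c_{k+1}=c_1$; the cyclic weight of a cycle is $\min(\operatorname{cdes}(c),\operatorname{casc}(c))$ and that of a permutation is the sum over its cycles. An odd order permutation has all cycles of odd length.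 $\mathscr{P}_{n,d}$ is the set of odd order permutations of $[n]$ with cyclic weight $d$, $p_{n,d}=\lvert\mathscr{P}_{n,d}\rvert$, and $p_{n,d}(i,j)$ is the number of $\pi\in\mathscr{P}_{n,d}$ with $\pi(i)=n$ and $\pi(n)=j$ (i.e. containing $i\,n\,j$ as a cyclic factor). *)

(* Defs.v *)
From mathcomp Require Import all_boot all_fingroup.
Set Implicit Arguments. Unset Strict Implicit. Unset Printing Implicit Defensive.

Definition adj_pairs (w : seq nat) : seq (nat * nat) := zip w (behead w).

Definition n_asc (w : seq nat) : nat := count (fun p => p.1 < p.2) (adj_pairs w).
Definition n_des (w : seq nat) : nat := count (fun p => p.1 > p.2) (adj_pairs w).

Definition ballot (w : seq nat) : bool :=
  [forall t : 'I_(size w).+1, n_des (take t w) <= n_asc (take t w)].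

Definition perms_n (n : nat) : seq (seq nat) := permutations (iota 1 n).

Definition B_set (n d : nat) : seq (seq nat) :=
  [seq w <- perms_n n | ballot w && (n_des w == d)].

Definition b_count (n d : nat) : nat := size (B_set n d).

Definition b_count_ij (n d i j : nat) : nat :=
  size [seq w <- B_set n d | infix [:: i; n; j] w].

(* A permutation of [n] is modelled as s : {perm 'I_n}, the element x : 'I_n
   standing for the integer x+1 of [n]; this relabelling is order preserving. *)

Definition odd_order (n : nat) (s : {perm 'I_n}) : bool :=
  [forall x, odd #|porbit s x|].

Definition cyc_weight_orbit (n : nat) (s : {perm 'I_n}) (A : {set 'I_n}) : nat :=
  minn #|[set x in A | s x < x]| #|[set x in A | x < s x]|.

Definition cyc_weight (n : nat) (s : {perm 'I_n}) : nat :=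
  \sum_(A in porbits s) cyc_weight_orbit s A.

Definition P_set (n d : nat) : {set {perm 'I_n}} :=
  [set s : {perm 'I_n} | odd_order s && (cyc_weight s == d)].

Definition p_count (n d : nat) : nat := #|P_set n d|.

Definition p_count_ij (n d i j : nat) : nat :=
  #|[set s in P_set n d | [exists x : 'I_n,
        [&& (val x).+1 == i, (val (s x)).+1 == n & (val (s (s x))).+1 == j]]]|.

(* Main.v *)
(** Splitting off the permutations in which the largest letter n is last (resp. a
    fixed point) gives b_{n,d} = b_{n-1,d} + sum_{i,j} b_{n,d}(i,j), and likewise for
    p, so by induction it suffices that b(i,j) + b(j,i) = 2 p(i,j) for all i, j < n.
    Both b and p satisfy the shift invariance f(i,j) = f(i+1,j+1), and p is symmetric
    (invert the permutation), which reduces everything to i = 1.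

    For p the shift is conjugation by the cycle (1 2 ... n-1): it turns n-1, a cyclic
    peak not adjacent to n, into a cyclic valley, so cyclic weights are unchanged.
    For b, delete the letter n-1 (resp. 1) from a word containing i n j (resp.
    i+1 n j+1): what remains is, after relabelling, the same word v, and one has to
    compare the ballot words obtained from v by inserting a top letter with those
    obtained by inserting a bottom letter.  For each v these are equinumerous. *)
Require Import Defs.
From mathcomp Require Import all_boot all_fingroup.
From mathcomp Require Import zify.
Set Implicit Arguments.
Unset Strict Implicit.
Unset Printing Implicit Defensive.

(** * Ballot words as nonnegative lattice paths *)

Definition steps (w : seq nat) : seq bool := [seq p.1 < p.2 | p <- adj_pairs w].

(** The path with up-steps [true] and down-steps [false], started at height [h], never goes below 0.
    The starting height is a parameter so that inductions can strip the first step. *)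
Fixpoint nonneg (h : nat) (u : seq bool) : bool :=
  match u with
  | [::] => true
  | true :: u' => nonneg h.+1 u'
  | false :: u' => if h is h'.+1 then nonneg h' u' else false
  end.

Definition good (d h : nat) (u : seq bool) : bool := nonneg h u && (count negb u == d).

Lemma good_true d h u : good d h (true :: u) = good d h.+1 u.
Proof. by rewrite /good /= add0n. Qed.

Lemma good_false d h u : good d.+1 h.+1 (false :: u) = good d h u.
Proof. by rewrite /good /= add1n eqSS. Qed.

Lemma good_false0 d u : good d 0 (false :: u) = false.
Proof. by []. Qed.

Lemma good_0false h u : good 0 h (false :: u) = false.
Proof. by rewrite /good /= add1n andbF. Qed.

Lemma nonneg_cat h u v :
  nonneg h (u ++ v) = nonneg h u && nonneg (h + count id u - count negb u) v.
Proof.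
elim: u h => [|[] u IH] h /=; first by rewrite addn0 subn0.
  by rewrite IH; congr (_ && nonneg _ _); lia.
by case: h => // h; rewrite IH; congr (_ && nonneg _ _); lia.
Qed.

Lemma nonnegP h u :
  reflect (forall t, count negb (take t u) <= h + count id (take t u)) (nonneg h u).
Proof.
elim: u h => [|[] u IH] h; first by apply: ReflectT.
  apply: (iffP (IH h.+1)) => P t.
    by case: t => [|t] //=; have := P t; lia.
  by have := P t.+1 => /=; lia.
case: h => [|h]; first by apply: ReflectF => /(_ 1); rewrite /= take0.
apply: (iffP (IH h)) => P t.
  by case: t => [|t] //=; have := P t; lia.
by have := P t.+1 => /=; lia.
Qed.

Lemma steps_cons x y w : steps (x :: y :: w) = (x < y) :: steps (y :: w).
Proof. by []. Qed.

Lemma size_steps w : size (steps w) = (size w).-1.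
Proof. by rewrite size_map size_zip size_behead; case: w => //= x w; lia. Qed.

Lemma steps_cat u x v : steps (u ++ x :: v) = steps (rcons u x) ++ steps (x :: v).
Proof. by elim: u => // y [|z u] //= IH; rewrite !steps_cons IH. Qed.

Lemma take_steps t w : take t (steps w) = steps (take t.+1 w).
Proof. by elim: w t => [|x [|y w] IH] [|t] //=; rewrite steps_cons -IH. Qed.

Lemma n_ascE w : n_asc w = count id (steps w).
Proof. by rewrite count_map. Qed.

(** Distinct letters admit no ties, so a step that is not an ascent is a descent. *)
Lemma n_desE w : uniq w -> n_des w = count negb (steps w).
Proof.
rewrite /n_des count_map; elim: w => [|x [|y w] IH] //= /andP[xw /IH ->].
by move: xw; rewrite inE negb_or => /andP[xy _]; congr (_ + _); lia.
Qed.

Lemma ballot_steps w : uniq w -> ballot w = nonneg 0 (steps w).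
Proof.
(* A prefix of [t.+1] letters has [t] steps; the empty prefix and values of [t] beyond the length of
   [w] are treated apart. *)
move=> uw; apply/forallP/nonnegP => P t.
  rewrite take_steps add0n -n_ascE -n_desE ?take_uniq //.
  have [le|/ltnW le] := leqP t.+1 (size w); first by have /= := P (@Ordinal (size w).+1 t.+1 le).
  by rewrite take_oversize //; have := P ord_max; rewrite take_size.
rewrite n_desE ?take_uniq // n_ascE; case: t => -[|t] /= lt; first by rewrite take0.
by rewrite -take_steps; apply: P.
Qed.

Lemma mem_B_set n d w : (w \in B_set n d) = (w \in perms_n n) && good d 0 (steps w).
Proof.
rewrite mem_filter andbC mem_permutations; case: (boolP (perm_eq _ _)) => //= /perm_uniq.
by rewrite iota_uniq => uw; rewrite ballot_steps // n_desE.
Qed.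

(** * Top and bottom insertions into a step sequence *)

(* The step sequence of a word after inserting, at position [k], a letter that is
   larger (b = true) or smaller (b = false) than all the others. *)
Definition ins_steps (b : bool) (k : nat) (u : seq bool) : seq bool :=
  if k is k'.+1 then
    if k' < size u then take k' u ++ [:: b, ~~ b & drop k'.+1 u] else rcons u b
  else ~~ b :: u.

Arguments ins_steps : simpl never.

(* A top and a bottom insertion inside [u] (or at its end) differ only at cuts of
   height 0.  Those at a descent match the paths first reaching -1 there, which are
   legal from height h+1 but not from h; those at an ascent match the paths leaving 0
   for good there, which end at positive height but are not legal from height h-1. *)
Lemma ins_steps_sum d h u :
  \sum_(k < size u) good d h (ins_steps true k.+1 u) + good d h (rcons u true)
    + (0 < h) && good d.-1 h.-1 u && (0 < d)
  = \sum_(k < size u) good d h (ins_steps false k.+1 u) + good d h (rcons u false)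
    + good d h.+1 u.
Proof.
elim: u d h => [|b u IH] d h /=.
  by rewrite !big_ord0 /good /=; case: h d => [|h] [|[|d]].
rewrite !big_ord_recl /=.
have ins0 c : ins_steps c 1 (b :: u) = [:: c, ~~ c & u] by rewrite /ins_steps /= drop0.
rewrite !ins0.
have insE c (k : 'I_(size u)) : ins_steps c (bump 0 k).+1 (b :: u) = b :: ins_steps c k.+1 u.
  by rewrite /ins_steps /bump /= add1n ltnS ltn_ord.
under eq_bigr do rewrite insE.
under [in RHS]eq_bigr do rewrite insE.
case: b {insE ins0} => /=.
  under eq_bigr do rewrite good_true.
  under [in RHS]eq_bigr do rewrite good_true.
  have := IH d h.+1; case: h d => [|h] [|d] /=;
    rewrite ?(good_true, good_false, good_false0, good_0false, andbT, andbF); lia.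
case: h d => [|h] [|d].
all: under eq_bigr do rewrite ?(good_false, good_false0, good_0false).
all: under [in RHS]eq_bigr do rewrite ?(good_false, good_false0, good_0false).
all: rewrite ?(good_true, good_false, good_false0, good_0false, andbT, andbF, big1_eq) //.
  by lia.
by have := IH d h; case: h {IH} => [|h]; case: d => [|d] /=;
    rewrite ?(good_true, good_false, good_false0, good_0false, andbT, andbF); lia.
Qed.

(** This is [ins_steps_sum] at height 0, its two extra terms being the insertions at the front.
    There a top letter creates an initial descent, which is illegal at height 0, and a bottom letter
    creates an initial ascent, after which [u] starts from height 1. *)
Lemma ins_steps_total d u :
  \sum_(k < (size u).+2) good d 0 (ins_steps true k u)
  = \sum_(k < (size u).+2) good d 0 (ins_steps false k u).
Proof.
rewrite [LHS]big_ord_recl [RHS]big_ord_recl big_ord_recr [in RHS]big_ord_recr /=.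
have insL c : ins_steps c (bump 0 (size u)) u = rcons u c by rewrite /ins_steps /bump /= ltnn.
have := ins_steps_sum d 0 u; rewrite !insL add0n [RHS]addnC /= addn0 => e.
have <- : good d 1 u = good d 0 (ins_steps false 0 u) by rewrite -good_true.
exact: e.
Qed.

Lemma ins_stepsS b k c u : ins_steps b k.+2 (c :: u) = c :: ins_steps b k.+1 u.
Proof. by rewrite /ins_steps /= ltnS; case: ltnP. Qed.

(** * Inserting a letter into a word *)

Definition ins (T : Type) (k : nat) (x : T) (v : seq T) : seq T := take k v ++ x :: drop k v.

Lemma map_ins (S T : Type) (f : S -> T) k x v : map f (ins k x v) = ins k (f x) (map f v).
Proof. by rewrite /ins map_cat /= map_take map_drop. Qed.

Lemma steps_ins b k x v : 0 < size v -> k <= size v ->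
  {in v, forall y, (y < x) = b /\ (x < y) = ~~ b} ->
  steps (ins k x v) = ins_steps b k (steps v).
Proof.
elim: v k => // y v IH [|k] _ /= kv vx.
  by rewrite /ins take0 drop0 cat0s steps_cons; have [_ ->] := vx y (mem_head _ _).
have [yx _] := vx y (mem_head _ _).
case: v IH vx kv => [|z v] IH vx; first by case: k => // _; rewrite /ins /= steps_cons yx.
case: k => [_|k kv].
  rewrite /ins /= !steps_cons yx; have [_ ->] := vx z ltac:(by rewrite !inE eqxx orbT).
  by rewrite /ins_steps /= drop0.
rewrite steps_cons ins_stepsS -IH //; last by move=> t tv; apply: vx; rewrite inE tv orbT.
Qed.

Lemma perm_ins (T : eqType) k (x : T) v : perm_eq (ins k x v) (x :: v).
Proof. by rewrite /ins perm_catC /= perm_cons perm_catC cat_take_drop. Qed.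

(** Cutting an arrangement at [x] shows that it arises by insertion. Both lists have the same
    length, so no arrangement arises twice. *)
Lemma perm_permutations_ins (T : eqType) (x : T) s : uniq (x :: s) ->
  perm_eq (permutations (x :: s))
    [seq ins k x t | t <- permutations s, k <- iota 0 (size s).+1].
Proof.
move=> uxs; set L := [seq ins _ _ _ | _ <- _, _ <- _].
have sub : {subset permutations (x :: s) <= L}.
  move=> w; rewrite mem_permutations => pw.
  have xw : x \in w by rewrite (perm_mem pw) mem_head.
  case/splitPr: xw pw => p q pw; apply/allpairsP; exists (p ++ q, size p); split.
  - rewrite mem_permutations -(perm_cons x) -(permPl (perm_ins (size p) x _)).
    by rewrite /ins take_size_cat ?drop_size_cat.
  - by have := perm_size pw; rewrite mem_iota size_cat /=; lia.
  - by rewrite /ins /= take_size_cat ?drop_size_cat.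
have sz : size L <= size (permutations (x :: s)).
  by rewrite size_allpairs !size_permutations ?size_iota //= ?factS; [lia | case/andP: uxs].
apply: uniq_perm; first exact: permutations_uniq.
  exact: leq_size_uniq (permutations_uniq _) sub sz.
by have [_] := uniq_min_size (permutations_uniq _) sub sz.
Qed.

(** Deleting [x] from the factorisation of [ins k x v] leaves [s] intact and gives back [v]. *)
Lemma infix_ins (T : eqType) (s v : seq T) k x :
  x \notin s -> x \notin v -> infix s (ins k x v) -> infix s v.
Proof.
move=> xs xv /infixP[p [q e]]; apply/infixP.
have fE (t : seq T) : x \notin t -> filter (predC1 x) t = t.
  by move=> xt; apply/all_filterP/allP => y yt; apply: contraNneq xt => <-.
exists (filter (predC1 x) p), (filter (predC1 x) q).
rewrite -{1}(fE s) // -!filter_cat -e /ins filter_cat /= eqxx /= -filter_cat cat_take_drop.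
by rewrite fE.
Qed.

Lemma infix_map (S T : eqType) (f : S -> T) s w : injective f ->
  infix (map f s) (map f w) = infix s w.
Proof.
move=> fI; apply/infixP/infixP => [[p [q e]]|[p [q ->]]]; last first.
  by exists (map f p), (map f q); rewrite !map_cat.
exists (take (size p) w), (drop (size p + size s) w); apply: (inj_map fI).
rewrite !map_cat map_take map_drop e take_size_cat // drop_cat.
by rewrite ltnNge leq_addr /= addKn drop_size_cat ?size_map.
Qed.

(** * Shift invariance of the ballot counts *)

(** The inverse of the cycle (1 2 ... n-1). It fixes [n] and everything outside [n], which makes it
    injective on all of [nat] once [1 < n]. *)
Definition unshift (n x : nat) : nat :=
  if x == 1 then n.-1 else if 1 < x < n then x.-1 else x.

Lemma unshift_inj n : 1 < n -> injective (unshift n).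
Proof.
move=> n1 x y; rewrite /unshift.
by case: (x =P 1); case: (y =P 1); case: (boolP (1 < x < n)); case: (boolP (1 < y < n)); lia.
Qed.

Lemma eq_steps_map (f g : nat -> nat) w :
  {in w &, forall x y, (f x < f y) = (g x < g y)} -> steps (map f w) = steps (map g w).
Proof.
elim: w => [|x [|y w] IH] // fg; rewrite /= !steps_cons; congr (_ :: _).
  by apply: fg; rewrite !inE eqxx ?orbT.
by apply: IH => a b aw bw; apply: fg; rewrite inE ?aw ?bw orbT.
Qed.

(** [unshift] turns 1 into n-1, whereas [f] turns it into n+1. The two order the letters alike
    except for the pair 1, n, and these are never adjacent because the neighbours [i], [j] of [n]
    differ from 1. Hence relabelling by [unshift] has the effect of making the letter 1 the
    largest. *)
Lemma steps_unshift n i j p q : 1 < n -> i != 1 -> j != 1 ->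
  uniq (p ++ [:: i; n; j] ++ q) -> {in p ++ [:: i; n; j] ++ q, forall x, 0 < x <= n} ->
  let f x := if x == 1 then n.+1 else x in
  steps (map (unshift n) (p ++ [:: i; n; j] ++ q)) = steps (map f (p ++ [:: i; n; j] ++ q)).
Proof.
move=> n1 i1 j1 uw bw f.
(* Away from [n] both relabellings induce the same order; the two steps at [n] are compared
   separately. *)
have cmp (s : seq nat) : {subset s <= p ++ [:: i; n; j] ++ q} -> n \notin s ->
    steps (map (unshift n) s) = steps (map f s).
  move=> sub ns; apply: eq_steps_map => x y xs ys.
  have /bw := sub x xs; have /bw := sub y ys.
  have : x != n by apply: contraNneq ns => <-.
  have : y != n by apply: contraNneq ns => <-.
  rewrite /unshift /f.
  by case: (x =P 1); case: (y =P 1); case: (boolP (1 < x < n)); case: (boolP (1 < y < n)); lia.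
have un : unshift n n = n by rewrite /unshift ltnn andbF; case: eqP => //; lia.
have fn : f n = n by rewrite /f; case: eqP => //; lia.
have E g : steps (map g (p ++ [:: i; n; j] ++ q))
    = steps (map g (rcons p i)) ++ [:: g i < g n, g n < g j & steps (map g (j :: q))].
  by rewrite map_cat /= steps_cat map_rcons.
have lt x : x \in p ++ [:: i; n; j] ++ q -> x != 1 -> x != n ->
    [/\ unshift n x < n, f x < n, (n < unshift n x) = false & (n < f x) = false].
  move=> /bw; rewrite /unshift /f => + /negPf x1; rewrite x1.
  by case: (boolP (1 < x < n)); split; lia.
have [ni nj] : n \notin rcons p i /\ n \notin j :: q.
  move: uw; rewrite -[_ ++ _ ++ q]/(p ++ i :: [:: n] ++ j :: q) -cat_rcons uniq_catCA /=.
  by rewrite mem_cat negb_or => /andP[/andP[]].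
rewrite !E !cmp //.
- rewrite un fn.
  have [|||-> -> _ _] := lt i; rewrite ?mem_cat ?inE ?eqxx ?orbT //.
    by apply: contraNneq ni => ->; rewrite mem_rcons mem_head.
  have [|||_ _ -> ->] := lt j; rewrite ?mem_cat ?inE ?eqxx ?orbT //.
  by apply: contraNneq nj => ->; rewrite mem_head.
- by move=> x xs; rewrite !mem_cat !inE in xs *; case/orP: xs => ->; rewrite ?orbT.
- by move=> x; rewrite mem_rcons !mem_cat !inE; case/orP => ->; rewrite ?orbT.
Qed.

(* [true; false] are the steps of the peak [i n j]: next to the peak, top and bottom
   insertions are legal under the same condition. *)
Lemma good_ins_peak d p q k :
  k = (size p).+1 \/ k = (size p).+2 ->
  good d 0 (ins_steps true k (p ++ [:: true, false & q]))
  = good d 0 (ins_steps false k (p ++ [:: true, false & q])).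
Proof.
have dropE (p' : seq bool) c r : drop (size p').+1 (p' ++ c :: r) = r.
  by rewrite -cat_rcons drop_size_cat ?size_rcons.
have E b p' c r : ins_steps b (size p').+1 (p' ++ c :: r) = p' ++ [:: b, ~~ b & r].
  by rewrite /ins_steps size_cat /= -addSnnS leq_addr take_size_cat // dropE.
have E' b : ins_steps b (size p).+2 (p ++ [:: true, false & q]) = p ++ [:: true, b, ~~ b & q].
  by rewrite -(cat_rcons true) -(size_rcons p true) E cat_rcons.
by case=> ->; rewrite ?E ?E' /good !nonneg_cat !count_cat /=; case: (0 + _ - _).
Qed.

(** For a fixed arrangement [v] of 2, ..., n, top and bottom insertions are equinumerous over all
    cuts, and also over the cuts that break the factor [i n j]. Subtracting leaves the cuts that
    preserve it. *)
Lemma sum_ins_peak n d i j v : 1 < n -> 1 < i -> 1 < j -> perm_eq v (iota 2 n.-1) ->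
  \sum_(k < n) (infix [:: i; n; j] (ins k 1 v)
                && good d 0 (steps (map (unshift n) (ins k 1 v))))
  = \sum_(k < n) (infix [:: i; n; j] (ins k 1 v) && good d 0 (steps (ins k 1 v))).
Proof.
move=> n1 i1 j1 pv; have vE x : x \in v -> 2 <= x <= n.
  by rewrite (perm_mem pv) mem_iota; lia.
have nv1 : 1 \notin v by apply/negP=> /vE.
have [/infixP[p [q ve]]|nv] := boolP (infix [:: i; n; j] v); last first.
  rewrite !big1 // => k _; case: (boolP (infix _ (ins _ _ _))) => //=;
    move=> /infix_ins nk; case/negP: nv; apply: nk => //; rewrite !inE; lia.
have sv : size v = n.-1 by rewrite (perm_size pv) size_iota.
have uv : uniq v by rewrite (perm_uniq pv) iota_uniq.
have kv (k : 'I_n) : k <= size v by rewrite sv; have := ltn_ord k; lia.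
(* Under [f] the inserted letter 1 becomes a top letter; without relabelling it is a bottom
   letter. *)
pose f x := if x == 1 then n.+1 else x.
have fv : map f v = v.
  by rewrite map_id_in // => x xv; rewrite /f; case: eqP xv nv1 => // -> ->.
have T k : k <= size v -> steps (map f (ins k 1 v)) = ins_steps true k (steps v).
  move=> lek; rewrite map_ins fv; apply: steps_ins => // [|y /vE]; first by rewrite sv; lia.
  by rewrite /f /=; lia.
have O k : k <= size v -> steps (ins k 1 v) = ins_steps false k (steps v).
  move=> lek; apply: steps_ins => // [|y /vE]; [rewrite sv|]; lia.
have TU (k : 'I_n) : infix [:: i; n; j] (ins k 1 v) ->
    steps (map (unshift n) (ins k 1 v)) = ins_steps true k (steps v).
  move=> /infixP[p' [q' e]]; rewrite -T // e; apply: steps_unshift => //; try lia.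
    by rewrite -e (perm_uniq (perm_ins _ _ _)) /= nv1.
  by move=> x; rewrite -e (perm_mem (perm_ins _ _ _)) inE => /orP[/eqP->|/vE]; lia.
have tot := ins_steps_total d (steps v).
have sn : (size (steps v)).+2 = n by rewrite size_steps sv; lia.
rewrite sn in tot.
pose F (k : 'I_n) := infix [:: i; n; j] (ins k 1 v).
have dec b : \sum_(k < n) good d 0 (ins_steps b k (steps v)) =
   \sum_(k < n) (F k && good d 0 (ins_steps b k (steps v)))
   + \sum_(k < n) (~~ F k && good d 0 (ins_steps b k (steps v))).
  by rewrite -big_split; apply: eq_bigr => k _; case: (F k) => /=; rewrite ?addn0 ?add0n.
(* Only the two cuts next to [n] inside the factor [i n j] break it, and there the step sequence has
   the peak required by [good_ins_peak]. *)
have out : \sum_(k < n) (~~ F k && good d 0 (ins_steps true k (steps v)))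
   = \sum_(k < n) (~~ F k && good d 0 (ins_steps false k (steps v))).
  apply: eq_bigr => k _; case: (boolP (F k)) => //= nF; congr nat_of_bool.
  have [in_ni nj] : i < n /\ j < n.
    have : i \in v by rewrite ve !mem_cat !inE eqxx ?orbT.
    have : j \in v by rewrite ve !mem_cat !inE eqxx ?orbT.
    move=> /vE hj /vE hi; move: uv.
    rewrite ve !cat_uniq /= !inE => /and3P[_ _].
    move: hi hj; lia.
  have -> : steps v = steps (rcons p i) ++ [:: true, false & steps (j :: q)].
    by rewrite ve /= steps_cat !steps_cons in_ni; congr (_ ++ [:: _, _ & _]); lia.
  apply: good_ins_peak; rewrite size_steps size_rcons /=.
  move: nF; rewrite /F /ins ve; have := kv k; rewrite ve !size_cat /=.
  move: (nat_of_ord k) => l lel.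
  have [lp|lp] := leqP l (size p).
    rewrite take_cat drop_cat; case/negP; move: lp; rewrite leq_eqVlt => /orP[/eqP ->|->].
      rewrite ltnn subnn take0 drop0 cats0; apply/infixP; exists (p ++ [:: 1]), q.
      by rewrite -catA.
    by apply/infixP; exists (take l p ++ 1 :: drop l p), q; rewrite -catA.
  have [lq|] := leqP (size p + 3) l; last first.
    by move=> + _; move: lp; move: (size p) => sp; lia.
  have -> : l = size (p ++ [:: i; n; j]) + (l - (size p + 3)).
    by rewrite size_cat /=; move: lq; move: (size p) => sp; lia.
  rewrite -[[:: i, n, j & q]]/([:: i; n; j] ++ q) catA takeD addnC -drop_drop.
  rewrite drop_size_cat // take_size_cat //; case/negP.
  by apply/infixP; eexists p, _; rewrite -!catA.
transitivity (\sum_(k < n) (F k && good d 0 (ins_steps true k (steps v)))).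
  by apply: eq_bigr => k _; congr nat_of_bool; rewrite /F; case: (boolP (infix _ _)) => //= /TU->.
transitivity (\sum_(k < n) (F k && good d 0 (ins_steps false k (steps v)))).
  by move: tot; rewrite !dec out => /addIn.
by apply: eq_bigr => k _; rewrite -O.
Qed.

Lemma b_count_sum n d : b_count n d = \sum_(w <- perms_n n) good d 0 (steps w).
Proof.
rewrite /b_count size_filter -sum1_count big_mkcond big_seq [RHS]big_seq.
apply: eq_bigr => w pw; have := mem_B_set n d w; rewrite pw mem_filter pw andbT /= => ->.
by case: good.
Qed.

Lemma b_count_ij_sum n d i j :
  b_count_ij n d i j = \sum_(w <- perms_n n) (infix [:: i; n; j] w && good d 0 (steps w)).
Proof.
rewrite /b_count_ij size_filter -sum1_count big_filter_cond big_mkcond big_seq [RHS]big_seq.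
apply: eq_bigr => w pw; have := mem_B_set n d w; rewrite pw mem_filter pw andbT /= => ->.
by rewrite andbC; case: (_ && _).
Qed.

(** [unshift n] permutes [n], so applying it letterwise permutes the words in [perms_n n]. *)
Lemma perm_perms_unshift n : 1 < n -> perm_eq (perms_n n) (map (map (unshift n)) (perms_n n)).
Proof.
move=> n1; have mI := inj_map (unshift_inj n1).
have uI : uniq (map (map (unshift n)) (perms_n n)) by rewrite map_inj_uniq ?permutations_uniq.
have sub : {subset map (map (unshift n)) (perms_n n) <= perms_n n}.
  move=> _ /mapP[w + ->]; rewrite !mem_permutations => pw.
  apply: perm_trans (perm_map _ pw) _.
  have us : uniq (map (unshift n) (iota 1 n)).
    by rewrite map_inj_uniq ?iota_uniq //; exact: unshift_inj.
  have sub : {subset map (unshift n) (iota 1 n) <= iota 1 n}.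
    move=> _ /mapP[x + ->]; rewrite !mem_iota /unshift.
    by case: (x =P 1); case: (boolP (1 < x < n)); lia.
  have [|_ e] := uniq_min_size us sub; first by rewrite size_map.
  by apply: uniq_perm; rewrite ?iota_uniq.
have [|_ e] := uniq_min_size uI sub; first by rewrite size_map.
by apply: uniq_perm => [||x]; rewrite ?permutations_uniq ?e.
Qed.

Lemma b_count_ij_shift m d i j : i < m -> j < m ->
  b_count_ij m.+2 d i.+1 j.+1 = b_count_ij m.+2 d i.+2 j.+2.
Proof.
(* The left sum is reindexed by [unshift], so that both sides run over words containing the factor
   with [i.+2] and [j.+2]; these are then grouped by the word [v] left after deleting the letter
   1. *)
move=> im jm; rewrite !b_count_ij_sum (perm_big _ (perm_perms_unshift (isT : 1 < m.+2))) /= big_map.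
have P : perm_eq (perms_n m.+2)
    [seq ins k 1 t | t <- permutations (iota 2 m.+1), k <- iota 0 m.+2].
  by have := @perm_permutations_ins _ 1 (iota 2 m.+1) (iota_uniq 1 m.+2); rewrite size_iota.
have sumE (F : nat -> nat) : \sum_(k <- iota 0 m.+2) F k = \sum_(k < m.+2) F k.
  by rewrite -(big_mkord xpredT) /index_iota subn0.
have mE : [:: i.+1; m.+2; j.+1] = map (unshift m.+2) [:: i.+2; m.+2; j.+2].
  by rewrite /unshift /= !ltnS im jm ltnn.
rewrite mE (perm_big _ P) [RHS](perm_big _ P) !big_allpairs_dep big_seq [RHS]big_seq.
apply: eq_bigr => v; rewrite mem_permutations => pv; rewrite !sumE.
have := @sum_ins_peak m.+2 d i.+2 j.+2 v isT isT isT pv => <-.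
by apply: eq_bigr => k _; rewrite infix_map //; apply: unshift_inj.
Qed.

(** * Recurrence for the ballot counts *)

Lemma b_count_ii n d i : b_count_ij n d i i = 0.
Proof.
rewrite b_count_ij_sum big_seq big1 // => w; rewrite mem_permutations => /perm_uniq.
rewrite iota_uniq; case: infixP => // -[p [q ->]].
by rewrite !cat_uniq /= !inE eqxx orbT /= !andbF.
Qed.

Lemma good_rcons_true d h u : good d h (rcons u true) = good d h u.
Proof. by rewrite /good -cats1 nonneg_cat count_cat /= andbT !addn0. Qed.

(** The first summand counts the words ending in [n.+1]. In any other good word [n.+1] is interior,
    and its two neighbours single out exactly one pair [i], [j]. *)
Lemma b_count_rec n d :
  b_count n.+1 d = b_count n d + \sum_(i < n) \sum_(j < n) b_count_ij n.+1 d i.+1 j.+1.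
Proof.
have E : \sum_(i < n) \sum_(j < n) b_count_ij n.+1 d i.+1 j.+1
    = \sum_(w <- perms_n n.+1) ((last 0 w != n.+1) && good d 0 (steps w)).
  transitivity (\sum_(i < n) \sum_(j < n) \sum_(w <- perms_n n.+1)
      (infix [:: i.+1; n.+1; j.+1] w && good d 0 (steps w))).
    by do 2!(apply: eq_bigr => ? _); rewrite b_count_ij_sum.
  under [LHS]eq_bigr do rewrite exchange_big /=.
  rewrite exchange_big /= big_seq [RHS]big_seq; apply: eq_bigr => w.
  rewrite mem_permutations => pw.
  have [gw|_] := boolP (good d 0 (steps w)); last first.
    by rewrite andbF big1 // => i _; rewrite big1 // => j _; rewrite andbF.
  transitivity (\sum_(i < n) \sum_(j < n) (infix [:: i.+1; n.+1; j.+1] w : nat)).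
    by do 2!(apply: eq_bigr => ? _); rewrite andbT.
  have uw : uniq w by rewrite (perm_uniq pw) iota_uniq.
  have wE x : (x \in w) = (0 < x <= n.+1) by rewrite (perm_mem pw) mem_iota; lia.
  have Nw : n.+1 \in w by rewrite wE; lia.
  case/splitPr: Nw pw gw uw wE => p q _ gw uw wE.
  (* As [n.+1] occurs once, a factor around it is read off from the end of [p] and the start of [q];
     the size tests exclude the default value 0. *)
  have infE i j : infix [:: i; n.+1; j] (p ++ n.+1 :: q)
      = (0 < size p) && (last 0 p == i) && (0 < size q) && (head 0 q == j).
    apply/infixP/idP => [[p' [q']] /eqP|].
      rewrite /= -(cat_rcons i) uniq_eqseq_pivotl // => /andP[/eqP-> /eqP->].
      by rewrite size_rcons last_rcons !eqxx.
    case/lastP: p {uw gw wE} => [|p i'] //; rewrite size_rcons last_rcons.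
    case: q => [|j' q] //=; rewrite ?andbF // !andbT => /andP[/eqP<- /eqP<-].
    by exists p, q; rewrite cat_rcons.
  under eq_bigr => i _ do under eq_bigr => j _ do rewrite infE.
  (* A leading [n.+1] followed by another letter would start the path with a descent from height
     0. *)
  have p0 : 0 < size q -> 0 < size p.
    case: p gw wE {uw infE} => // gw wE; case: q gw wE => // y q /=; rewrite steps_cons => + wE _.
    have -> : (n.+1 < y) = false by have := wE y; rewrite !inE eqxx orbT; lia.
    by rewrite good_false0.
  rewrite last_cat /= andbT.
  have [q0|q0] := posnP (size q).
    rewrite (size0nil q0) eqxx big1 // => i _; rewrite big1 // => j _.
    by rewrite andbF.
  have [Np Nq] : n.+1 \notin p /\ n.+1 \notin q.
    move: uw; rewrite -[_ :: q]/([:: n.+1] ++ q) uniq_catCA /= mem_cat negb_or.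
    by case/andP=> /andP[].
  have lastq : last n.+1 q \in q by case: q q0 {uw gw wE infE p0 Nq} => //= y q _; exact: mem_last.
  have headq : head 0 q \in q.
    by case: q q0 {uw gw wE infE p0 Nq lastq} => //= y q _; exact: mem_head.
  have lastp : last 0 p \in p.
    have {p0} := p0 q0; case: p {uw gw wE infE Np} => //= y p _; exact: mem_last.
  have -> : last n.+1 q != n.+1 by apply: contraNneq Nq => <-.
  rewrite (p0 q0) /=; under eq_bigr => i _ do under eq_bigr => j _ do rewrite andbT.
  have hqE : 0 < head 0 q <= n.
    have := wE (head 0 q); rewrite mem_cat inE headq !orbT.
    have : head 0 q != n.+1 by apply: contraNneq Nq => <-.
    lia.
  have lpE : 0 < last 0 p <= n.
    have := wE (last 0 p); rewrite mem_cat lastp /=.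
    have : last 0 p != n.+1 by apply: contraNneq Np => <-.
    lia.
  have lti : (last 0 p).-1 < n by lia.
  have ltj : (head 0 q).-1 < n by lia.
  rewrite (bigD1 (Ordinal lti)) //= [X in _ + X]big1 => [|i]; last first.
    rewrite -val_eqE /= => ni; rewrite big1 // => j _.
    by rewrite [_ == i.+1](_ : _ = false) //; lia.
  rewrite addn0 (bigD1 (Ordinal ltj)) //= big1 => [|j].
    by rewrite !prednK ?eqxx; lia.
  by rewrite -val_eqE /= => nj; rewrite [_ == j.+1](_ : _ = false) ?andbF //; lia.
rewrite E !b_count_sum {E}.
have uN : uniq (n.+1 :: iota 1 n) by rewrite /= iota_uniq mem_iota; lia.
have P : perm_eq (perms_n n.+1) [seq ins k n.+1 t | t <- perms_n n, k <- iota 0 n.+1].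
  have := perm_permutations_ins uN; rewrite size_iota; apply: perm_trans.
  by apply: perm_permutations; rewrite -[X in iota 1 X]addn1 iotaD cats1 perm_rcons add1n.
(* Appending [n.+1] to [v] adds only a final ascent, which affects neither legality nor the number
   of descents; an insertion elsewhere leaves a letter of [v] last. *)
have -> : \sum_(w <- perms_n n) good d 0 (steps w)
    = \sum_(w <- perms_n n.+1) ((last 0 w == n.+1) && good d 0 (steps w)).
  rewrite (perm_big _ P) big_allpairs_dep big_seq [RHS]big_seq; apply: eq_bigr => v.
  rewrite mem_permutations => pv.
  have sv : size v = n by rewrite (perm_size pv) size_iota.
  have Nv : n.+1 \notin v by rewrite (perm_mem pv) mem_iota; lia.
  rewrite -[iota 0 n.+1]/(index_iota 0 n.+1) big_mkord big_ord_recr /= big1 => [|k _].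
    rewrite {1 2}/ins -sv take_size drop_size last_cat eqxx add0n cats1.
    case: (posnP (size v)) => [/size0nil -> //|v0].
    rewrite -cats1 -{2}[v]take_size -(drop_size v) -/(ins _ _ _) (@steps_ins true) //.
      have -> : size v = (size (steps v)).+1 by rewrite size_steps prednK.
      by rewrite /ins_steps ltnn good_rcons_true.
    by move=> y; rewrite (perm_mem pv) mem_iota; lia.
  rewrite /ins last_cat /= [_ == _](_ : _ = false) //; apply/negbTE.
  have : 0 < size (drop k v) by rewrite size_drop sv subn_gt0.
  have sub : {subset drop k v <= v} by move=> x; apply: mem_drop.
  case: (drop k v) sub => //= y r sub _; apply: contraNneq Nv => <-.
  exact/sub/mem_last.
by rewrite -big_split; apply: eq_bigr => w _; case: eqP; rewrite /= ?addn0.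
Qed.

(** * Cycles under conjugation and inversion *)

(** The map [f] may go between different types: it serves both for conjugation and for embedding [n]
    into [n+1]. *)
Lemma porbit_semiconj (S T : finType) (f : S -> T) (s : {perm S}) (t : {perm T}) :
  (forall x, t (f x) = f (s x)) -> forall x, porbit t (f x) = f @: porbit s x.
Proof.
move=> tf x.
have tfX k y : (t ^+ k)%g (f y) = f ((s ^+ k)%g y).
  by elim: k y => [|k IH] y; rewrite ?expg0 ?perm1 // !expgS !permM tf IH.
apply/setP=> y; apply/porbitP/imsetP=> [[k ->]|[z /porbitP[k ->] ->]].
  by exists ((s ^+ k)%g x); rewrite ?mem_porbit.
by exists k.
Qed.

Lemma porbits_conj (T : finType) (s t u : {perm T}) :
  (forall x, t (u x) = u (s x)) -> porbits t = [set u @: A | A : {set T} in porbits s].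
Proof.
move=> tu; apply/setP=> A; apply/imsetP/imsetP=> [[x _ ->]|[_ /imsetP[x _ ->] ->]].
  exists (porbit s (u^-1 x)%g); first exact: imset_f.
  by rewrite -(porbit_semiconj tu) permKV.
by exists (u x); rewrite ?(porbit_semiconj tu).
Qed.

Lemma odd_order_conj n (s t u : {perm 'I_n}) :
  (forall x, t (u x) = u (s x)) -> odd_order t = odd_order s.
Proof.
move=> tu; apply/forallP/forallP=> sP x.
  by have := sP (u x); rewrite (porbit_semiconj tu) card_imset; last exact: perm_inj.
rewrite -[x](permKV u) (porbit_semiconj tu) card_imset //; exact: perm_inj.
Qed.

Lemma cyc_weight_conj n (s t u : {perm 'I_n}) :
  (forall x, t (u x) = u (s x)) ->
  {in porbits s, forall A : {set 'I_n}, cyc_weight_orbit t (u @: A) = cyc_weight_orbit s A} ->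
  cyc_weight t = cyc_weight s.
Proof.
move=> tu tA; rewrite /cyc_weight (porbits_conj tu) big_imset /=.
  by apply: eq_bigr => A /tA.
by move=> A B _ _ /imset_inj-> //; apply: perm_inj.
Qed.

Lemma odd_orderV n (s : {perm 'I_n}) : odd_order s^-1 = odd_order s.
Proof. by apply: eq_forallb => x; rewrite porbitV. Qed.

Lemma porbit_stable (T : finType) (s : {perm T}) (A : {set T}) x :
  A \in porbits s -> (s x \in A) = (x \in A).
Proof.
case/imsetP=> y _ ->; rewrite -!eq_porbit_mem.
by have /= := porbit_perm s 1 x; rewrite expg1 => ->.
Qed.

(** Inversion keeps the orbits, and [s] maps the ascents of [s] in an orbit onto the descents of its
    inverse, and descents onto ascents. The minimum is symmetric in the two. *)
Lemma cyc_weightV n (s : {perm 'I_n}) : cyc_weight s^-1 = cyc_weight s.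
Proof.
rewrite /cyc_weight porbitsV; apply: eq_bigr => A sA; rewrite /cyc_weight_orbit minnC.
congr minn; rewrite -[RHS](card_imset _ (@perm_inj _ s)); apply: eq_card => x;
  (apply/idP/imsetP=> [|[y]]; rewrite inE => /andP[Ax lx];
    last by move=> ->; rewrite inE permK porbit_stable // Ax);
  (exists ((s^-1)%g x); rewrite ?permKV // inE permKV lx andbT);
  by rewrite -(porbit_stable _ sA) permKV.
Qed.

Lemma p_count_ijC n d i j : p_count_ij n d i j = p_count_ij n d j i.
Proof.
rewrite /p_count_ij -[RHS](card_imset _ (@invg_inj _)); apply: eq_card => s.
have aux (t : {perm 'I_n}) (k l : nat) :
    t \in [set s in P_set n d | [exists x : 'I_n,
      [&& (val x).+1 == k, (val (s x)).+1 == n & (val (s (s x))).+1 == l]]] ->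
    (t^-1)%g \in [set s in P_set n d | [exists x : 'I_n,
      [&& (val x).+1 == l, (val (s x)).+1 == n & (val (s (s x))).+1 == k]]].
  rewrite !inE odd_orderV cyc_weightV => /andP[-> /existsP[x /and3P[xk sx ssx]]] /=.
  by apply/existsP; exists (t (t x)); rewrite ssx !permK sx.
apply/idP/imsetP=> [/aux|[t /aux ? ->]] //.
by exists (s^-1)%g; rewrite ?invgK.
Qed.

(** * Shift invariance of the odd order counts *)

Definition shift_fun m (x : 'I_m.+2) : 'I_m.+2 :=
  if x < m then inord x.+1 else if x == m :> nat then ord0 else ord_max.

Lemma shift_funE m (x : 'I_m.+2) :
  shift_fun x = (if x < m then x.+1 else if x == m :> nat then 0 else m.+1) :> nat.
Proof. by rewrite /shift_fun; case: ltnP => ?; [rewrite inordK //; lia | case: eqP]. Qed.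

Lemma shift_fun_inj m : injective (@shift_fun m).
Proof.
move=> x y /(congr1 val) /=; rewrite !shift_funE => e; apply/val_inj => /=.
have := ltn_ord x; have := ltn_ord y; move: (nat_of_ord x) (nat_of_ord y) e => p q.
by case: (ltnP p m); case: (ltnP q m); case: (p =P m); case: (q =P m); lia.
Qed.

(* The permutation (0 1 ... m) of ['I_m.+2], which fixes the largest element. *)
Definition shift_perm m : {perm 'I_m.+2} := perm (@shift_fun_inj m).

Lemma shift_permE m (x : 'I_m.+2) :
  shift_perm m x = (if x < m then x.+1 else if x == m :> nat then 0 else m.+1) :> nat.
Proof. by rewrite permE shift_funE. Qed.

Lemma shift_perm_eq m (x : 'I_m.+2) i :
  i < m -> (shift_perm m x == i.+1 :> nat) = (x == i :> nat).
Proof. by rewrite shift_permE; have := ltn_ord x; case: (ltnP x m); case: (x =P m :> nat); lia. Qed.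

Lemma shift_perm_eq_max m (x : 'I_m.+2) :
  (shift_perm m x == m.+1 :> nat) = (x == m.+1 :> nat).
Proof. by rewrite shift_permE; have := ltn_ord x; case: (ltnP x m); case: (x =P m :> nat); lia. Qed.

(** Here [a] stands for the letter n-1 and [m.+1] for n. If [a] is not fixed it is a cyclic peak,
    since neither neighbour is n, and the shift turns it into the minimum, a cyclic valley. The
    descent out of [a] is traded for one out of its predecessor [b]. *)
Lemma card_shift_des m (s : {perm 'I_m.+2}) (A : {set 'I_m.+2}) (a : 'I_m.+2) :
  a = m :> nat -> s a < m.+1 -> (s^-1)%g a < m.+1 -> A \in porbits s ->
  #|[set x in A | shift_perm m (s x) < shift_perm m x]| = #|[set x in A | s x < x]|.
Proof.
move=> am sa; set b := (s^-1)%g a => bm sA.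
have sb : s b = a by rewrite permKV.
have monS (x y : 'I_m.+2) : x != a -> y != a -> (shift_perm m x < shift_perm m y) = (x < y).
  rewrite -!val_eqE /= am !shift_permE => xa ya.
  have := ltn_ord x; have := ltn_ord y; move: (nat_of_ord x) (nat_of_ord y) xa ya => p q.
  by case: (ltnP p m); case: (ltnP q m); case: (p =P m); case: (q =P m); lia.
have sxa x : (s x == a) = (x == b) by rewrite -sb (inj_eq perm_inj).
have [ab|ab] := eqVneq b a.
  apply: eq_card => x; rewrite !inE.
  have [->|xa] := eqVneq x a; first by move: (sb); rewrite ab => ->; rewrite !ltnn.
  by rewrite monS // sxa ab.
have saa : s a != a by rewrite sxa eq_sym.
have ca : shift_perm m a = 0 :> nat by rewrite shift_permE am ltnn eqxx.
have cpos x : x != a -> 0 < shift_perm m x.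
  by rewrite lt0n -ca val_eqE (inj_eq perm_inj).
(* Removing [b] from the shifted descents and [a] from the original ones leaves equal sets, since
   the shift is increasing away from [a]. *)
rewrite (cardsD1 b) [RHS](cardsD1 a) !inE sb ca cpos // -(porbit_stable b sA) sb.
have -> : s a < a by move: saa; rewrite -val_eqE /= am; lia.
congr (_ + _); apply: eq_card => x; rewrite !inE.
have [->|xa] := eqVneq x a; first by rewrite ca ltn0 !andbF.
have [->|xb] := eqVneq x b; last by rewrite monS // sxa.
have ba : (b : nat) <> m by move=> ?; case/eqP: ab; apply: val_inj; rewrite /= am.
rewrite sb [a < b](_ : _ = false) ?andbF //; lia.
Qed.

Lemma card_shift_asc m (s : {perm 'I_m.+2}) (A : {set 'I_m.+2}) (a : 'I_m.+2) :
  a = m :> nat -> s a < m.+1 -> (s^-1)%g a < m.+1 -> A \in porbits s ->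
  #|[set x in A | shift_perm m x < shift_perm m (s x)]| = #|[set x in A | x < s x]|.
Proof.
move=> am sa; set b := (s^-1)%g a => bm sA.
have sb : s b = a by rewrite permKV.
(* Under any relabelling [f], ascents, descents and fixed points fill the orbit, and the fixed
   points do not depend on [f]. Equality of descents thus forces equality of ascents. *)
have aux (f : {perm 'I_m.+2}) :
    #|[set x in A | f x < f (s x)]| + #|[set x in A | f (s x) < f x]|
      + #|[set x in A | s x == x]| = #|A|.
  have cE (P : pred 'I_m.+2) : #|[set x in A | P x]| = \sum_(x in A) P x.
    by rewrite -sum1dep_card big_mkcondr; apply: eq_bigr => x _; case: (P x).
  rewrite !cE -!big_split -sum1_card; apply: eq_bigr => x _ /=.
  by rewrite -(inj_eq (@perm_inj _ f)) -val_eqE /=; case: ltngtP.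
have := aux (shift_perm m); rewrite (@card_shift_des _ _ _ a) //.
have <- := aux 1%g.
have -> : #|[set x in A | (1%g : {perm 'I_m.+2}) x < (1%g : {perm 'I_m.+2}) (s x)]|
    = #|[set x in A | x < s x]|.
  by apply: eq_card => x; rewrite !inE !perm1.
have -> : #|[set x in A | (1%g : {perm 'I_m.+2}) (s x) < (1%g : {perm 'I_m.+2}) x]|
    = #|[set x in A | s x < x]|.
  by apply: eq_card => x; rewrite !inE !perm1.
lia.
Qed.

Lemma cyc_weight_shift m (s t : {perm 'I_m.+2}) (a : 'I_m.+2) :
  a = m :> nat -> s a < m.+1 -> (s^-1)%g a < m.+1 ->
  (forall x, t (shift_perm m x) = shift_perm m (s x)) -> cyc_weight t = cyc_weight s.
Proof.
move=> am sa bm ts; apply: (cyc_weight_conj ts) => A sA.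
rewrite /cyc_weight_orbit -(@card_shift_des _ s A a) // -(@card_shift_asc _ s A a) //.
congr minn; rewrite -[RHS](card_imset _ (@perm_inj _ (shift_perm m))); apply: eq_card => y;
  (apply/idP/imsetP=> [|[x xA ->]];
    last by move: xA; rewrite !inE ts mem_imset //; exact: perm_inj);
  by rewrite inE => /andP[/imsetP[x xA ->]]; rewrite ts => lt; exists x; rewrite // inE xA.
Qed.

Lemma p_count_ij_shift m d i j : i < m -> j < m ->
  p_count_ij m.+2 d i.+1 j.+1 = p_count_ij m.+2 d i.+2 j.+2.
Proof.
move=> im jm; rewrite /p_count_ij.
set S := [set s in _ | _]; set T := [set s in _ | _].
rewrite -[RHS](@on_card_preimset _ _ (fun s => s ^ shift_perm m)%g); last first.
  by apply: onW_bij; exists (fun s => s ^ (shift_perm m)^-1)%g => s; rewrite ?conjgK ?conjgKV.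
apply: eq_card => s; rewrite !inE.
set t := (s ^ shift_perm m)%g.
have ts x : t (shift_perm m x) = shift_perm m (s x) by rewrite /t conjgE !permM permK.
rewrite (odd_order_conj ts).
set E := [exists x, _]; set E' := [exists x, _].
have EE' : E = E'.
  apply/existsP/existsP=> [[x e]|[x e]].
    by exists (shift_perm m x); rewrite !ts /= !eqSS shift_perm_eq_max !shift_perm_eq // -!eqSS.
  exists (((shift_perm m)^-1)%g x); move: e; rewrite -{1 2 3}[x](permKV (shift_perm m)).
  by rewrite !ts /= !eqSS shift_perm_eq_max !shift_perm_eq //.
rewrite EE'; have [e|] := boolP E'; rewrite ?andbF // !andbT.
rewrite -EE' in e; have [x /and3P[xi sx ssx]] := existsP e.
(* The element [m] is not adjacent to the largest one, whose neighbours have the values [i] and [j],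
   both below [m]. *)
have am : (inord m : 'I_m.+2) = m :> nat by rewrite inordK.
rewrite (@cyc_weight_shift _ s t (inord m)) //.
  have ne : s (inord m) <> s x.
    by move/perm_inj => /(congr1 val) /=; rewrite am; move: xi => /=; lia.
  have := ltn_ord (s (inord m)); have : (s (inord m) : nat) <> s x by move/val_inj/ne.
  by move: sx => /=; lia.
set b := (s^-1)%g _; have sb : s b = inord m by rewrite permKV.
suff : b <> s x.
  by move=> ne; have := ltn_ord b; have : (b : nat) <> s x; [move/val_inj/ne | move: sx => /=; lia].
by move=> bx; move: ssx; rewrite -bx sb /= am; lia.
Qed.

(** * Recurrence for the odd order counts *)

Section LiftMax.
Variables (n : nat) (s : {perm 'I_n}).
Let t := lift_perm ord_max ord_max s.

Let tl x : t (lift ord_max x) = lift ord_max (s x).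
Proof. exact: lift_perm_lift. Qed.

Let porbit_max : porbit t ord_max = [set ord_max].
Proof.
apply/setP=> y; rewrite inE; apply/porbitP/eqP => [[k ->]|->]; last by exists 0; rewrite perm1.
by elim: k => [|k IH]; rewrite ?perm1 // expgS permM lift_perm_id.
Qed.

Lemma odd_order_lift_max : odd_order t = odd_order s.
Proof.
apply/forallP/forallP=> sP x.
  by have := sP (lift ord_max x); rewrite (porbit_semiconj tl) card_imset //; exact: lift_inj.
have [y ->|->] := unliftP ord_max x; last by rewrite porbit_max cards1.
by rewrite (porbit_semiconj tl) card_imset //; exact: lift_inj.
Qed.

Lemma cyc_weight_lift_max : cyc_weight t = cyc_weight s.
Proof.
(* The orbits of [t] are the lifted orbits of [s] and the singleton of the new fixed point, which
   has odd size and weight 0. *)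
have -> : cyc_weight t = \sum_(A in [set ord_max] |:
      [set lift ord_max @: A | A : {set 'I_n} in porbits s])
    cyc_weight_orbit t A.
  apply: eq_bigl => A; rewrite in_setU1; apply/imsetP/orP=> [[x _ ->]|[/eqP->|]].
  - have [y ->|->] := unliftP ord_max x; last by rewrite porbit_max eqxx; left.
    by right; rewrite (porbit_semiconj tl) imset_f // imset_f.
  - by exists ord_max.
  - case/imsetP=> _ /imsetP[y _ ->] ->; exists (lift ord_max y) => //.
    by rewrite (porbit_semiconj tl).
rewrite big_setU1 /=; last first.
  apply/imsetP=> -[A _] /setP/(_ ord_max); rewrite inE eqxx; case/esym/imsetP=> x _.
  by move/eqP; rewrite (negPf (neq_lift _ _)).
rewrite big_imset /=; last by move=> A B _ _ /imset_inj-> //; exact: lift_inj.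
rewrite {1}/cyc_weight_orbit (_ : [set x in _ | _] = set0); last first.
  by apply/setP=> x; rewrite !inE; case: eqP => // ->; rewrite lift_perm_id ltnn.
rewrite cards0 min0n; apply: eq_bigr => A _; rewrite /cyc_weight_orbit.
congr minn; rewrite -[RHS](card_imset _ (@lift_inj _ ord_max)); apply: eq_card => y;
  (apply/idP/imsetP=> [|[x xA ->]];
    last by move: xA; rewrite !inE tl !lift_max mem_imset //; exact: lift_inj);
  by rewrite inE => /andP[/imsetP[x xA ->]]; rewrite tl !lift_max => lt;
    exists x; rewrite // inE xA.
Qed.

End LiftMax.

Lemma card_P_set_fix_max n d :
  #|[set t in P_set n.+1 d | t ord_max == ord_max]| = p_count n d.
Proof.
have inj : injective (@lift_perm n ord_max ord_max).
  move=> s1 s2 e; apply/permP=> x; apply: (@lift_inj _ ord_max).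
  by rewrite -!(lift_perm_lift ord_max) e.
rewrite /p_count -[RHS](card_imset _ inj); apply: eq_card => t.
apply/idP/imsetP=> [|[s]]; last first.
  by rewrite !inE => ss ->; rewrite odd_order_lift_max cyc_weight_lift_max ss lift_perm_id eqxx.
rewrite !inE => /andP[tP /eqP tmax].
have tne x : ord_max != t (lift ord_max x).
  by rewrite -{1}tmax (inj_eq perm_inj) neq_lift.
(* The default [x] is never taken: by [tne], [t] sends no lifted element to [ord_max]. *)
pose f x := odflt x (unlift ord_max (t (lift ord_max x))).
have fE x : lift ord_max (f x) = t (lift ord_max x).
  by rewrite /f; case: unliftP (tne x) => [y ->|->] //; rewrite eqxx.
have finj : injective f by move=> x y /(congr1 (lift ord_max)); rewrite !fE => /perm_inj/lift_inj.
have te : t = lift_perm ord_max ord_max (perm finj).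
  apply/permP=> x; have [y ->|->] := unliftP ord_max x; last by rewrite lift_perm_id.
  by rewrite lift_perm_lift permE fE.
by exists (perm finj) => //; rewrite inE -(odd_order_lift_max (perm finj)) -cyc_weight_lift_max -te.
Qed.

Lemma odd_order_no_2cycle n (s : {perm 'I_n}) x : odd_order s -> s (s x) = x -> s x = x.
Proof.
move=> /forallP/(_ x) o ssx; apply/eqP; apply: contraLR o => sx.
suff -> : porbit s x = [set x; s x] by rewrite cards2 eq_sym sx.
apply/setP=> y; rewrite !inE; apply/porbitP/orP=> [[k ->]|[]/eqP->].
- elim: k => [|k]; rewrite ?perm1 ?expgSr ?permM; first by left.
  by case=> /eqP->; rewrite ?ssx eqxx; [right | left].
- by exists 0; rewrite perm1.
- by exists 1; rewrite expg1.
Qed.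

(** A cyclic factor [i n i] would close up to a cycle of length 2, which is even. *)
Lemma p_count_ii n d i : i < n -> p_count_ij n d i i = 0.
Proof.
move=> ltin; apply: eq_card0 => s; rewrite !inE; apply/negP=> /andP[/andP[os _]].
case/existsP=> x /and3P[/eqP xi /eqP sx /eqP ssx].
have /(odd_order_no_2cycle os) e : s (s x) = x by apply: val_inj; apply: succn_inj; rewrite ssx xi.
by rewrite e xi in sx; rewrite sx ltnn in ltin.
Qed.

Lemma p_count_rec n d :
  p_count n.+1 d = p_count n d + \sum_(i < n) \sum_(j < n) p_count_ij n.+1 d i.+1 j.+1.
Proof.
rewrite -(card_P_set_fix_max n) {1}/p_count
  -(cardsID [set t : {perm 'I_n.+1} | t ord_max == ord_max] (P_set _ _)).
congr (_ + _); first by apply: eq_card => t; rewrite !inE.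
transitivity (\sum_(i < n) \sum_(j < n) \sum_(s in P_set n.+1 d)
    ([exists x : 'I_n.+1, [&& (val x).+1 == i.+1, (val (s x)).+1 == n.+1
       & (val (s (s x))).+1 == j.+1]] : nat)); last first.
  apply: eq_bigr => i _; apply: eq_bigr => j _; rewrite /p_count_ij -sum1dep_card big_mkcondr.
  by apply: eq_bigr => s _; case: [exists x, _].
under eq_bigr do rewrite exchange_big /=.
rewrite exchange_big /= -sum1_card; under eq_bigl do rewrite inE andbC.
rewrite big_mkcondr /=; apply: eq_bigr => s sP; rewrite inE.
(* The witness [x] can only be the preimage of [ord_max], so preimage and image of [ord_max]
   determine the pair [i], [j]. *)
have exE (i j : 'I_n) : [exists x : 'I_n.+1, [&& (val x).+1 == i.+1, (val (s x)).+1 == n.+1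
       & (val (s (s x))).+1 == j.+1]] = ((s^-1)%g ord_max == i :> nat) && (s ord_max == j :> nat).
  apply/existsP/andP=> [[x /and3P[/eqP[xi] sx /eqP[ssx]]]|[ei ej]].
    have sxm : s x = ord_max by apply: val_inj; move/eqP: sx => [].
    by rewrite -sxm permK xi sxm in ssx *; rewrite ssx.
  by exists ((s^-1)%g ord_max); rewrite !permKV !eqSS ei ej eqxx.
under eq_bigr => i _ do under eq_bigr => j _ do rewrite exE.
have [e|ne] /= := eqVneq.
  by rewrite big1 // => i _; rewrite big1 // => j _; rewrite e /= (gtn_eqF (ltn_ord j)) andbF.
have lti : (s^-1)%g ord_max < n.
  have := ltn_ord ((s^-1)%g ord_max); rewrite ltnS leq_eqVlt => /orP[/eqP smax|//].
  case/eqP: ne; rewrite -{2}[ord_max](permKV s); congr (s _); apply: val_inj; exact/esym.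
have ltj : s ord_max < n.
  have := ltn_ord (s ord_max); rewrite ltnS leq_eqVlt => /orP[/eqP smax|//].
  by case/eqP: ne; apply: val_inj.
rewrite (bigD1 (Ordinal lti)) //= [X in _ + X]big1 => [|i]; last first.
  rewrite -val_eqE /= => ni; rewrite big1 // => j _; by rewrite eq_sym (negPf ni).
rewrite addn0 (bigD1 (Ordinal ltj)) //= big1 => [|j]; first by rewrite !eqxx.
by rewrite -val_eqE /= eq_sym => /negPf->; rewrite andbF.
Qed.

(** * Induction on n *)

Lemma b_count_p_count0 d : b_count 0 d = p_count 0 d.
Proof.
have w0 (s : {perm 'I_0}) : cyc_weight s = 0
  by rewrite /cyc_weight big1 // => A /imsetP[x]; have := ltn_ord x.
rewrite b_count_sum /= big_seq1 /p_count /good /=.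
have -> : P_set 0 d = if 0 == d then setT else set0.
  apply/setP=> s; rewrite inE w0.
  have -> : odd_order s by apply/forallP=> x; have := ltn_ord x.
  by case: eqP; rewrite inE.
by case: eqP => _; rewrite ?cards0 // cardsT card_Sn.
Qed.

Lemma b_count_ij_shiftn m d i j k : i + k <= m -> j + k <= m ->
  b_count_ij m.+2 d (i + k).+1 (j + k).+1 = b_count_ij m.+2 d i.+1 j.+1.
Proof.
elim: k => [|k IH]; rewrite ?addn0 // !addnS => im jm.
by rewrite -b_count_ij_shift // IH // ltnW.
Qed.

Lemma p_count_ij_shiftn m d i j k : i + k <= m -> j + k <= m ->
  p_count_ij m.+2 d (i + k).+1 (j + k).+1 = p_count_ij m.+2 d i.+1 j.+1.
Proof.
elim: k => [|k IH]; rewrite ?addn0 // !addnS => im jm.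
by rewrite -p_count_ij_shift // IH // ltnW.
Qed.

Unset Implicit Arguments.

Theorem theorem3p4 :
  (forall n d j : nat, 3 <= n -> 2 <= j -> j <= n - 1 ->
     b_count_ij n d 1 j + b_count_ij n d j 1 = 2 * p_count_ij n d 1 j) ->
  forall n d : nat, 1 <= n -> d <= (n - 1)./2 -> b_count n d = p_count n d.
Proof.
move=> hyp n d _ _.
(* The hypothesis covers pairs whose first letter is 1. Symmetry and shifts extend it to all pairs;
   on the diagonal both sides vanish. *)
have bp m i j : i <= m -> j <= m ->
    b_count_ij m.+2 d i.+1 j.+1 + b_count_ij m.+2 d j.+1 i.+1 = 2 * p_count_ij m.+2 d i.+1 j.+1.
  wlog lt : i j / i < j => [W im jm|_ jm].
    have [/W|/W|->] := ltngtP i j; first exact; last by rewrite b_count_ii p_count_ii.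
    by rewrite addnC p_count_ijC; apply.
  (* Shifting down by [i] moves the pair to the letters 1 and [k.+2], within the range of [hyp]. *)
  have [k je] : exists k, j = k.+1 + i by exists (j - i.+1); lia.
  have im : 0 + i <= m by lia.
  rewrite je in jm *; rewrite (@b_count_ij_shiftn m d 0 k.+1 i) //.
  rewrite (@b_count_ij_shiftn m d k.+1 0 i) //.
  rewrite (@p_count_ij_shiftn m d 0 k.+1 i) //; apply: hyp; lia.
elim: n => [|n IH]; first exact: b_count_p_count0.
rewrite b_count_rec p_count_rec IH; congr (_ + _).
case: n {IH} => [|m]; first by rewrite !big_ord0.
(* The double sums are doubled and one copy of the ballot sum is transposed, so that [bp] applies
   term by term. *)
apply/eqP; rewrite -(eqn_pmul2l (isT : 0 < 2)) !mul2n -addnn {2}exchange_big /=.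
rewrite -addnn -!big_split /=; apply/eqP; apply: eq_bigr => i _.
rewrite -!big_split /=; apply: eq_bigr => j _.
by rewrite bp ?mul2n ?addnn // -ltnS.
Qed.
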